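(* Let $N, W, L, M$ be positive integers and $\mathbf{w}\in\mathbb{C}^W$ a window such that (i) $\mathbf{w}$ is non-vanishing ($w[n]\neq0$ for $0\le n\le W-1$); (ii) $2L\le W\le \frac{N}{2}$; (iii) $4L\le M\le N$. Then for almost all non-vanishing $\mathbf{x}_0\in\mathbb{C}^N$ (all $\mathbf{x}_0$ with every entry nonzero, except a Lebesgue-null set), when the entries $x_0[n]$, $0\le n\le\lfloor L/2\rfloor$, are known a priori, the only $N\times N$ Hermitian positive semidefinite matrix $\mathbf{X}$ satisfying $$\operatorname{trace}(\mathbf{W}_r^\star\mathbf{f}_m\mathbf{f}_m^\star\mathbf{W}_r\mathbf{X})=Z_w[m,r]\quad\text{for all }1\le m\le M,\ 0\le r\le R-1,$$ together with the prior-information constraints $X[n,k]=x_0[n]\overline{x_0[k]}$ for $0\le n,k\le\lfloor L/2\rfloor$, is $\mathbf{X}_0=\mathbf{x}_0\mathbf{x}_0^\star$. In particular, the semidefinite program minimizing $\operatorname{trace}(\mathbf{X})$ over these constraints has the unique feasible (hence optimal) point $\mathbf{x}_0\mathbf{x}_0^\star$.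
   Context: The window is extended by $w[k]=0$ for $k\notin\{0,\dots,W-1\}$; $R=\lceil (N+W-1)/L\rceil$. For $0\le r\le R-1$, $\mathbf{W}_r$ is the $N\times N$ diagonal matrix with diagonal entries $w[rL-n]$, $n=0,\dots,N-1$. For integer $m$, $\mathbf{f}_m\in\mathbb{C}^N$ has entries $f_m[n]=e^{i2\pi mn/N}$ (the conjugate of the $m$th column of the $N$-point DFT matrix, indices modulo $N$), and $\star$ denotes conjugate transpose. The measurements are the STFT magnitudes of $\mathbf{x}_0$: $Z_w[m,r]=|\mathbf{f}_m^\star\mathbf{W}_r\mathbf{x}_0|^2=\big|\sum_{n=0}^{N-1}x_0[n]w[rL-n]e^{-i2\pi mn/N}\big|^2$. The a priori knowledge of the entries $x_0[n]$, $0\le n\le\lfloor L/2\rfloor$, is incorporated into the program as the linear constraints on the corresponding block of $\mathbf{X}$ stated in the claim. *)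

(* Defs.v *)
From HB Require Import structures.
From mathcomp Require Import all_boot all_order all_algebra.
From mathcomp Require Import complex.
From mathcomp Require Import reals trigo.
Set Implicit Arguments. Unset Strict Implicit. Unset Printing Implicit Defensive.
Import Order.TTheory GRing.Theory Num.Theory.
Local Open Scope ring_scope.
Local Open Scope complex_scope.

Section Defs.
Variable R : realType.
Local Notation C := R[i].

Definition expi (t : R) : C := cos t +i* sin t.

Definition adjmx m n (A : 'M[C]_(m, n)) : 'M[C]_(n, m) := (map_mx Num.conj A)^T.

Definition wext W (w : 'I_W -> C) (k : int) : C :=
  match k with
  | Posz n => if (insub n : option 'I_W) is Some j then w j else 0
  | Negz _ => 0
  end.

(* R = ceil((N+W-1)/L) (for L > 0) *)
Definition nframes (N W L : nat) : nat := ((N + W - 1) + L - 1) %/ L.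

Definition fvec (N m : nat) : 'cV[C]_N :=
  \col_(n < N) expi (2 * pi * m%:R * (n : nat)%:R / N%:R).

Definition Wmat (N W L : nat) (w : 'I_W -> C) (r : nat) : 'M[C]_N :=
  diag_mx (\row_(n < N) wext w ((r * L)%:Z - (n : nat)%:Z)).

Definition colv N (x : 'I_N -> C) : 'cV[C]_N := \col_(n < N) x n.

Definition Zw N W L (w : 'I_W -> C) (x0 : 'I_N -> C) (m r : nat) : C :=
  `|(adjmx (fvec N m) *m Wmat N L w r *m colv x0) ord0 ord0| ^+ 2.

Definition hermitian N (X : 'M[C]_N) : Prop := adjmx X = X.

Definition psd N (X : 'M[C]_N) : Prop :=
  forall v : 'cV[C]_N, 0 <= (adjmx v *m X *m v) ord0 ord0.

Definition feasible N W L M (w : 'I_W -> C) (x0 : 'I_N -> C) (X : 'M[C]_N) : Prop :=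
  [/\ hermitian X, psd X,
      (forall m r : nat, (1 <= m <= M)%N -> (r < nframes N W L)%N ->
         \tr (adjmx (Wmat N L w r) *m fvec N m *m adjmx (fvec N m) *m Wmat N L w r *m X)
           = Zw L w x0 m r) &
      (forall n k : 'I_N, (n <= L./2)%N -> (k <= L./2)%N ->
         X n k = x0 n * Num.conj (x0 k))].

(* Lebesgue-null subsets of C^N = R^(2N): coverable, for every eps > 0, by a
   sequence of closed boxes of total volume <= eps. *)
Definition null_set N (E : ('I_N -> C) -> Prop) : Prop :=
  forall eps : R, 0 < eps ->
  exists ar br ai bi : nat -> 'I_N -> R,
    (forall k i, ar k i <= br k i /\ ai k i <= bi k i) /\
    (forall x, E x -> exists k, forall i,
        ar k i <= complex.Re (x i) <= br k i /\ ai k i <= complex.Im (x i) <= bi k i) /\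
    (forall K : nat,
        \sum_(k < K) \prod_(i < N) ((br k i - ar k i) * (bi k i - ai k i)) <= eps).

End Defs.

(* Main.v *)
(** Frame r only sees indices up to rL, and the block of X on
    [0, (r-1)L] (on [0, L/2] for r = 1) is already known to be x0 x0^*; we show
    that frame r determines the block on [0, rL].  Since the known block has
    rank one, a Schur complement gives X = v v^* + S with S positive
    semidefinite, with v = x0 and S = 0 on the known indices.  With A(z) the
    part of the windowed z-transform of x0 coming from the known indices and
    delta that of v - x0 on the new ones, the measurements of frame r say
    2 Re (conj A delta) + Q = 0 at 4L points of the unit circle, where Q is a
    trigonometric polynomial of degree < L.  This is a linear system in
    (delta, Q).  If it is injective then delta = 0 and Q = 0, and the constant
    term of Q is then the weighted trace of S over the new indices, so S
    vanishes there.

    Injectivity is generic.  Let k be a known index at distance greater than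
    every difference of two new indices from all new indices, and at most
    2L - 1 from them.  Moving Re x0[k] by tau adds tau V to the matrix of the
    system, where V is a Vandermonde matrix with 4L - 1 exponents and 4L
    distinct nodes.  Hence the bad x0 are zeros of a function that is monic
    polynomial in Re x0[k] and locally Lipschitz in all coordinates; such a
    zero set is null because on a small cube the roots stay close to those at
    one point of the cube. *)

Require Import Defs.
From HB Require Import structures.
From mathcomp Require Import all_boot all_order all_algebra.
From mathcomp Require Import complex.
From mathcomp Require Import boolp reals trigo.
From mathcomp Require Import zify ring lra.
Set Implicit Arguments.
Unset Strict Implicit.
Unset Printing Implicit Defensive.
Import Order.TTheory GRing.Theory Num.Theory.
Local Open Scope ring_scope.

(** * Null sets *)

(** Coordinates range over an arbitrary finite type, so that a single real coordinate such as Re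
    x0[k] can be varied alone. *)
Definition box_null (R : realType) (J : finType) (E : (J -> R) -> Prop) : Prop :=
  forall eps : R, 0 < eps -> exists a b : nat -> J -> R,
    [/\ forall k j, a k j <= b k j,
        forall x, E x -> exists k, forall j, a k j <= x j <= b k j &
        forall K : nat, \sum_(k < K) \prod_j (b k j - a k j) <= eps].

Definition of_coords (R : realType) (N : nat) (c : 'I_N * bool -> R) (n : 'I_N) : R[i] :=
  (c (n, true) +i* c (n, false))%C.

Lemma box_null_set (R : realType) (N : nat) (E : ('I_N -> R[i]) -> Prop) :
  box_null (fun c => E (of_coords c)) -> null_set E.
Proof.
move=> nE eps eps0; have [a [b [ab cov vol]]] := nE eps eps0.
exists (fun k i => a k (i, true)), (fun k i => b k (i, true)).
exists (fun k i => a k (i, false)), (fun k i => b k (i, false)).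
split; last split.
- by move=> k i; split; apply: ab.
- move=> x Ex.
  pose c (j : 'I_N * bool) := if j.2 then complex.Re (x j.1) else complex.Im (x j.1).
  have cx : of_coords c = x.
    by apply/funext => n; rewrite /of_coords /c /=; case: (x n).
  have [|k ck] := cov c; first by rewrite cx.
  by exists k => i; split; [have := ck (i, true) | have := ck (i, false)].
- move=> K; apply: le_trans (vol K); apply: ler_sum => k _.
  rewrite le_eqVlt; apply/orP; left; apply/eqP.
  transitivity (\prod_i \prod_c (b k (i, c) - a k (i, c))).
    by apply: eq_bigr => i _; rewrite big_bool.
  by rewrite pair_bigA; apply: eq_bigr => -[].
Qed.

Lemma sum_uniq_le (R : realDomainType) (T : eqType) (s s' : seq T) (F : T -> R) :
  uniq s -> uniq s' -> {subset s <= s'} -> (forall t, 0 <= F t) ->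
  \sum_(t <- s) F t <= \sum_(t <- s') F t.
Proof.
move=> us us' ss' F0.
rewrite [leRHS](bigID (mem s)) /= -(big_filter s' (mem s)) -[leLHS]addr0.
apply: lerD; last exact: sumr_ge0.
rewrite le_eqVlt; apply/orP; left; apply/eqP/perm_big/uniq_perm => //.
  exact: filter_uniq.
by move=> t; rewrite mem_filter /=; case: (boolP (t \in s)) => // /ss' ->.
Qed.

(** Gaps in the enumeration of the countable type are filled with the box reduced to the point 0.
    Its volume is 0 only if there is at least one coordinate, which [j0] provides. *)
Lemma box_null_count (R : realType) (J : finType) (j0 : J) (E : (J -> R) -> Prop) :
  (forall eps : R, 0 < eps -> exists (T : countType) (a b : T -> J -> R),
    [/\ forall t j, a t j <= b t j,
        forall x, E x -> exists t, forall j, a t j <= x j <= b t j &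
        forall s : seq T, uniq s -> \sum_(t <- s) \prod_j (b t j - a t j) <= eps]) ->
  box_null E.
Proof.
move=> H eps /H [T [a [b [ab cov vol]]]].
exists (fun k j => oapp (a ^~ j) 0 (pickle_inv k)).
exists (fun k j => oapp (b ^~ j) 0 (pickle_inv k)); split.
- by move=> k j; case: (pickle_inv k) => //=.
- move=> x /cov [t xt]; exists (pickle t) => j; rewrite pickleK_inv; exact: xt.
- move=> K; rewrite -(big_mkord xpredT (fun k => \prod_j
    (oapp (b ^~ j) 0 (pickle_inv k) - oapp (a ^~ j) 0 (pickle_inv k)))).
  pose F t := \prod_j (b t j - a t j).
  rewrite (eq_bigr (fun k => oapp F 0 (pickle_inv k))); last first.
    move=> k _; case: (pickle_inv k) => //=.
    by rewrite (bigD1 j0) //= subrr mul0r.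
  rewrite -big_pmap; apply: vol.
  exact: (pmap_uniq (@pickle_invK T) (iota_uniq _ _)).
Qed.

Lemma sum_geometric_half (R : realType) (e : R) (K : nat) :
  0 <= e -> \sum_(k < K) e / 2 ^+ k.+1 <= e.
Proof.
move=> e0; suff -> : \sum_(k < K) e / 2 ^+ k.+1 = e - e / 2 ^+ K.
  by rewrite gerBl divr_ge0 // exprn_ge0.
elim: K => [|K IH]; first by rewrite big_ord0 expr0 divr1 subrr.
rewrite big_ord_recr /= IH exprS.
have : (2 : R) ^+ K != 0 by rewrite expf_neq0 ?pnatr_eq0.
by move: (2 ^+ K) => y y0; field.
Qed.

Lemma box_null_bigcup (R : realType) (J : finType) (j0 : J)
    (E : nat -> (J -> R) -> Prop) :
  (forall n, box_null (E n)) -> box_null (fun x => exists n, E n x).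
Proof.
move=> nE; apply: (box_null_count j0) => eps eps0.
have /choice [a /choice [b abP]] : forall n, exists a, exists b : nat -> J -> R,
    [/\ forall k j, a k j <= b k j,
        forall x, E n x -> exists k, forall j, a k j <= x j <= b k j &
        forall K : nat, \sum_(k < K) \prod_j (b k j - a k j) <= eps / 2 ^+ n.+1].
  by move=> n; apply: nE; rewrite divr_gt0 // exprn_gt0.
exists (nat * nat)%type, (fun t => a t.1 t.2), (fun t => b t.1 t.2); split.
- by move=> t j; have [+ _ _] := abP t.1; apply.
- by move=> x [n]; have [_ + _] := abP n => /[apply] -[k xk]; exists (n, k).
- move=> s us.
  (* A finite set of pairs lies in a square of side [K], whose row n has total volume at most eps /
     2^(n+1). *)
  pose K := (\max_(t <- s) maxn t.1 t.2).+1.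
  pose F (t : nat * nat) := \prod_j (b t.1 t.2 j - a t.1 t.2 j).
  have F0 t : 0 <= F t.
    by apply: prodr_ge0 => j _; rewrite subr_ge0; have [+ _ _] := abP t.1; apply.
  apply: (@le_trans _ _
    (\sum_(t <- [seq (n, k) | n <- iota 0 K, k <- iota 0 K]) F t)).
    apply: sum_uniq_le => //.
      by apply: allpairs_uniq; rewrite ?iota_uniq // => -[? ?] [? ?].
    move=> [n k] nks; apply/allpairsP; exists (n, k).
    have : (maxn n k < K)%N.
      rewrite ltnS; exact: (leq_bigmax_seq (F := fun t : nat * nat => maxn t.1 t.2) _ nks).
    by rewrite gtn_max !mem_iota /= !add0n => /andP[-> ->].
  rewrite big_allpairs; apply: le_trans (sum_geometric_half K (ltW eps0)).
  rewrite -(big_mkord xpredT (fun k => eps / 2 ^+ k.+1)) /index_iota subn0.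
  apply: ler_sum => n _; have [_ _ /(_ K)] := abP n.
  by rewrite -(big_mkord xpredT (fun k => \prod_j (b n k j - a n k j)))
    /index_iota subn0.
Qed.

(** * Locally Lipschitz functions *)

Local Open Scope complex_scope.

(** Lipschitz on every cube for the sup distance. A bound on the cube is carried along because the
    product rule needs one. *)
Definition loclip (R : realType) (J : finType) (f : (J -> R) -> R[i]) : Prop :=
  forall B : R, exists K : R, [/\ 0 <= K,
    forall x, (forall j, `|x j| <= B) -> `|f x| <= K%:C &
    forall x y h, 0 <= h -> (forall j, `|x j| <= B) -> (forall j, `|y j| <= B) ->
      (forall j, `|x j - y j| <= h) -> `|f x - f y| <= (K * h)%:C].

Section LocLip.
Variables (R : realType) (J : finType).
Implicit Types f g : (J -> R) -> R[i].

Lemma normc_real (a : R) : `|a%:C| = `|a|%:C :> R[i].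
Proof. by rewrite normc_def /= expr0n addr0 sqrtr_sqr. Qed.

Lemma loclip_ext f g : f =1 g -> loclip f -> loclip g.
Proof.
move=> fg lf B; have [K [K0 Kf Lf]] := lf B; exists K; split=> //.
  by move=> x ?; rewrite -fg; apply: Kf.
by move=> x y h ? ? ? ?; rewrite -!fg; apply: Lf.
Qed.

Lemma loclip_const (c : R[i]) : loclip (fun _ : J -> R => c).
Proof.
move=> B; exists (complex.Re `|c|).
have e : (complex.Re `|c|)%:C = `|c| by rewrite RRe_real // normr_real.
have K0 : 0 <= complex.Re `|c| by rewrite -ler0c e.
by split=> // x y h h0 _ _ _; rewrite subrr normr0 ler0c mulr_ge0.
Qed.

Lemma loclip_coord (j : J) : loclip (fun x : J -> R => (x j)%:C).
Proof.
move=> B; exists (`|B| + 1); split; first by rewrite addr_ge0.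
- move=> x xB; rewrite normc_real lecR; apply: le_trans (xB j) _.
  by apply: le_trans (ler_norm B) _; rewrite lerDl.
- move=> x y h h0 _ _ xy; rewrite -rmorphB normc_real lecR.
  by apply: le_trans (xy j) _; rewrite mulrDl mul1r lerDr mulr_ge0.
Qed.

Lemma loclipD f g : loclip f -> loclip g -> loclip (fun x => f x + g x).
Proof.
move=> lf lg B; have [K [K0 Kf Lf]] := lf B; have [M [M0 Mg Lg]] := lg B.
exists (K + M); split; first exact: addr_ge0.
- move=> x xB; rewrite rmorphD; apply: le_trans (ler_normD _ _) _.
  by apply: lerD; [apply: Kf | apply: Mg].
- move=> x y h h0 xB yB xy; rewrite mulrDl rmorphD opprD addrACA.
  apply: le_trans (ler_normD _ _) _.
  by apply: lerD; [apply: Lf | apply: Lg].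
Qed.

Lemma loclipM f g : loclip f -> loclip g -> loclip (fun x => f x * g x).
Proof.
move=> lf lg B; have [K [K0 Kf Lf]] := lf B; have [M [M0 Mg Lg]] := lg B.
exists (K * M + M * K); split; first by rewrite !addr_ge0 ?mulr_ge0.
- move=> x xB; rewrite normrM; apply: (@le_trans _ _ (K * M)%:C).
    by rewrite rmorphM ler_pM //; [apply: Kf | apply: Mg].
  by rewrite lecR lerDl mulr_ge0.
- move=> x y h h0 xB yB xy.
  have -> : f x * g x - f y * g y = f x * (g x - g y) + g y * (f x - f y) by ring.
  apply: le_trans (ler_normD _ _) _; rewrite !normrM.
  apply: (@le_trans _ _ (K%:C * (M * h)%:C + M%:C * (K * h)%:C)).
    apply: lerD; apply: ler_pM => //; by [apply: Kf|apply: Lg|apply: Mg|apply: Lf].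
  rewrite -!rmorphM -rmorphD lecR.
  by rewrite mulrDl !mulrA.
Qed.

Lemma loclip_sum (I : Type) (r : seq I) (P : pred I) (F : I -> (J -> R) -> R[i]) :
  (forall i, P i -> loclip (F i)) -> loclip (fun x => \sum_(i <- r | P i) F i x).
Proof.
move=> lF; elim: r => [|i r IH].
  by apply: (loclip_ext _ (loclip_const 0)) => x; rewrite big_nil.
case: (boolP (P i)) => Pi.
  by apply: (loclip_ext _ (loclipD (lF i Pi) IH)) => x; rewrite big_cons Pi.
by apply: (loclip_ext _ IH) => x; rewrite big_cons (negPf Pi).
Qed.

Lemma loclip_prod (I : Type) (r : seq I) (F : I -> (J -> R) -> R[i]) :
  (forall i, loclip (F i)) -> loclip (fun x => \prod_(i <- r) F i x).
Proof.
move=> lF; elim: r => [|i r IH].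
  by apply: (loclip_ext _ (loclip_const 1)) => x; rewrite big_nil.
by apply: (loclip_ext _ (loclipM (lF i) IH)) => x; rewrite big_cons.
Qed.

Lemma loclip_conj f : loclip f -> loclip (fun x => Num.conj (f x)).
Proof.
move=> lf B; have [K [K0 Kf Lf]] := lf B; exists K; split=> //.
  by move=> x ?; rewrite norm_conjC; apply: Kf.
by move=> x y h ? ? ? ?; rewrite -rmorphB norm_conjC; apply: Lf.
Qed.

Lemma loclip_det (n : nat) (A : (J -> R) -> 'M[R[i]]_n) :
  (forall i k, loclip (fun x => A x i k)) -> loclip (fun x => \det (A x)).
Proof.
move=> lA; apply: loclip_sum => s _.
apply: loclipM; first exact: loclip_const.
by apply: loclip_prod => i; apply: lA.
Qed.
End LocLip.

(** * Zero sets of functions monic in one coordinate *)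

Definition upd (R : realType) (J : finType) (x : J -> R) (j0 : J) (t : R) : J -> R :=
  fun j => if j == j0 then t else x j.

(** A product of d+1 distances to roots, each greater than eta, exceeds eta^(d+1). As t is real,
    replacing a root by its real part does not increase its distance to t. *)
Lemma monic_small_near_root (R : realType) (p : {poly R[i]}) (d : nat) :
  p \is monic -> size p = d.+2 ->
  exists rho : 'I_d.+1 -> R, forall t eta : R, 0 <= eta ->
    `|p.[t%:C]| <= (eta ^+ d.+1)%:C -> exists i, `|t - rho i| <= eta.
Proof.
move=> pm sp; have [r pE] := closed_field_poly_normal p.
move: pE; rewrite (monicP pm) scale1r => pE.
have sr : size r = d.+1 by move: sp; rewrite pE size_prod_XsubC => -[].
exists (fun i => complex.Re r`_i) => t eta eta0 H.
case: (boolP [exists k : 'I_d.+1, `|t - complex.Re r`_k| <= eta]) => [/existsP//|].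
rewrite negb_exists => /forallP far; exfalso.
have {}far z : z \in r -> eta%:C < `|t%:C - z|.
  move=> /(nthP 0)-[k]; rewrite sr => ir <-; have := far (Ordinal ir).
  rewrite -ltNge -ltcR => /lt_le_trans; apply.
  by have := normc_ge_Re (t%:C - r`_k); rewrite raddfB.
suff : (eta ^+ d.+1)%:C < `|p.[t%:C]| by move/lt_geF; rewrite H.
rewrite pE horner_prod normr_prod rmorphXn -sr /=.
under eq_bigr do rewrite hornerXsubC.
(* The strict inequality fails for the empty product, so the induction keeps the list nonempty. *)
have : r != [::] by case: (r) sr.
elim: r {pE sr} far => // z r IH far _; rewrite big_cons /= exprS.
have lt1 : eta%:C < `|t%:C - z| by apply: far; rewrite mem_head.
have e0 : 0 <= eta%:C :> R[i] by rewrite ler0c.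
have [->|rn] := eqVneq r [::]; first by rewrite big_nil expr0 !mulr1.
apply: ltr_pM => //; first exact: exprn_ge0.
by apply: IH => // z' z'r; apply: far; rewrite inE z'r orbT.
Qed.

(** A cube is cut into columns parallel to the [j0]-axis. Within one column, the [j0] coordinate of
    a zero of [f] is close to one of d+1 numbers depending only on a corner of the column, so d+1
    thin boxes cover the zeros there. *)
Lemma box_null_zeros (R : realType) (J : finType) (j0 : J) (d : nat)
    (f : (J -> R) -> R[i]) :
  loclip f ->
  (forall y, exists p : {poly R[i]}, [/\ p \is monic, size p = d.+2 &
     forall t, f (upd y j0 t) = p.[t%:C]]) ->
  box_null (fun x => f x = 0).
Proof.
move=> lf fp.
suff nB (m : nat) : box_null (fun x => f x = 0 /\ forall j, `|x j| <= m%:R).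
  move=> eps eps0.
  have [a [b [ab cov vol]]] := box_null_bigcup j0 nB eps0.
  exists a, b; split=> // x fx; apply: cov.
  exists (Num.truncn (\sum_j `|x j|)).+1; split=> // j.
  apply: ltW; apply: le_lt_trans (truncnS_gt _).
  by rewrite (bigD1 j) //= lerDl sumr_ge0.
apply: (box_null_count j0) => eps eps0.
have [K [K0 _ Lf]] := lf (m%:R + 1).
(* The margin 1 keeps [B] positive and puts every [x j] strictly below [B], so that its cell number
   is less than [n]. *)
pose B : R := m%:R + 1.
have B0 : 0 < B by rewrite ltr_wpDl.
have B20 : 0 < 2 * B by rewrite mulr_gt0.
pose V := (2 * B) ^+ #|J|.-1.
have V0 : 0 < V by rewrite exprn_gt0.
(* Over a base of total volume [V], d+1 boxes of height 2 * eta add up to exactly eps. *)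
pose eta : R := eps / (2 * d.+1%:R * V).
have eta0 : 0 < eta by rewrite divr_gt0 // mulr_gt0 // mulr_gt0.
(* Makes the mesh [h] so fine that moving to the corner of a column changes [f] by at most
   eta^(d+1). *)
pose n := (Num.truncn (K * (2 * B) / eta ^+ d.+1)).+1.
have n0 : 0 < n%:R :> R by rewrite ltr0n.
pose h := 2 * B / n%:R.
have h0 : 0 < h by rewrite divr_gt0.
have hn : h * n%:R = 2 * B by rewrite divfK ?gt_eqF.
have Kh : K * h <= eta ^+ d.+1.
  rewrite /h mulrA ler_pdivrMr // [leRHS]mulrC -ler_pdivrMr ?exprn_gt0 //.
  exact: ltW (truncnS_gt _).
(* This is the lower corner of the cell, not its midpoint. *)
pose ctr (c : {ffun J -> 'I_n}) (j : J) : R := h * (c j)%:R - B.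
have /choice [rho rhoP] : forall c, exists rho : 'I_d.+1 -> R, forall t eta' : R,
    0 <= eta' -> `|f (upd (ctr c) j0 t)| <= (eta' ^+ d.+1)%:C ->
    exists i, `|t - rho i| <= eta'.
  move=> c; have [p [pm sp fE]] := fp (ctr c).
  have [rho rhoP] := monic_small_near_root pm sp.
  by exists rho => t e' e0; rewrite fE; apply: rhoP.
(* The grid also cuts the j0-axis, where only the roots matter: the boxes of
   all but the first slice are collapsed to volume zero. *)
pose len (j : J) (c : 'I_n) : R :=
  if j == j0 then (if c == 0 :> nat then 2 * eta else 0) else h.
have len0 j c : 0 <= len j c.
  by rewrite /len; case: ifP => _; last exact: ltW; case: ifP => // _; rewrite mulr_ge0 ?(ltW eta0).
pose a (t : {ffun J -> 'I_n} * 'I_d.+1) (j : J) : R :=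
  if j == j0 then rho t.1 t.2 - eta else ctr t.1 j.
exists ({ffun J -> 'I_n} * 'I_d.+1)%type, a, (fun t j => a t j + len j (t.1 j)).
split.
- by move=> t j; rewrite lerDl.
- move=> x [fx xm].
  have xB j : 0 <= (x j + B) / h < n%:R.
    have := xm j; rewrite ler_norml => /andP[x1 x2].
    apply/andP; split; first by apply: divr_ge0; [rewrite /B; lra | exact: ltW].
    by rewrite ltr_pdivrMr // /h mulrCA divff ?gt_eqF // mulr1 /B; lra.
  pose c : {ffun J -> 'I_n} := [ffun j =>
    inord (if j == j0 then 0 else Num.truncn ((x j + B) / h))].
  have cE : forall j, j != j0 -> ctr c j <= x j <= ctr c j + h.
    move=> j jj0; have /andP[x1 x2] := xB j.
    have /andP[t1 t2] := truncn_itv x1.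
    rewrite /ctr ffunE (negPf jj0) inordK; last first.
      by rewrite -(ltr_nat R) (le_lt_trans t1).
    move: t1 t2; rewrite ler_pdivlMr // ltr_pdivrMr // -natr1 [(_ + 1) * h]mulrDl mul1r.
    by rewrite ![_%:R * h]mulrC => t1 t2; apply/andP; split; lra.
  have cB j : `|ctr c j| <= B.
    rewrite ler_norml /ctr; have : (c j)%:R <= n%:R :> R by rewrite ler_nat ltnW.
    rewrite -(ler_pM2l h0) hn => ch.
    have ch' : 0 <= h * (c j)%:R by rewrite mulr_ge0 ?(ltW h0).
    by move: (h * _) ch ch' B0 => y y1 y2 y3; apply/andP; split; lra.
  have xB' j : `|x j| <= B by apply: le_trans (xm j) _; rewrite lerDl.
  have [|i iP] := rhoP c (x j0) eta (ltW eta0).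
    apply: (@le_trans _ _ (K * h)%:C); last by rewrite lecR.
    rewrite -[f _]subr0 -fx; apply: Lf; first exact: ltW.
    + by move=> j; rewrite /upd; case: eqP.
    + exact: xB'.
    + move=> j; rewrite /upd; case: eqP => [->|/eqP /cE /andP[x1 x2]].
        by rewrite subrr normr0 ltW.
      by rewrite ler_norml; apply/andP; split; lra.
  exists (c, i) => j; rewrite /a /len /=; case: eqP => [->|/eqP /cE //].
  rewrite ffunE eqxx inordK //=; move: iP; rewrite ler_norml => /andP[i1 i2].
  by apply/andP; split; lra.
- move=> s us.
  apply: (@le_trans _ _ (\sum_(t : {ffun J -> 'I_n} * 'I_d.+1) \prod_j len j (t.1 j))).
    under eq_bigr do under eq_bigr do rewrite addrAC subrr add0r.
    apply: sum_uniq_le => //; first exact: index_enum_uniq.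
      by move=> t _; rewrite mem_index_enum.
    by move=> t; apply: prodr_ge0.
  (* Summed over the grid, the product of side lengths factors over the coordinates: 2 * eta along
     [j0] and n * h = 2 * B along each other axis. *)
  rewrite -(pair_bigA _ (fun (c : {ffun J -> 'I_n}) _ => \prod_j len j (c j))) /= exchange_big /=.
  rewrite sumr_const card_ord -bigA_distr_bigA /= (bigD1 j0) //=.
  rewrite [X in _ * X *+ _](eq_bigr (fun=> 2 * B)); last first.
    move=> j jj0; rewrite /len (negPf jj0) sumr_const card_ord.
    by rewrite -hn mulr_natr.
  rewrite prodr_const cardC1 -/V /len eqxx.
  rewrite (bigD1 ord0) //= big1 ?addr0; last first.
    by move=> i; rewrite -val_eqE /= => /negPf ->.
  rewrite -mulr_natr le_eqVlt; apply/orP; left; apply/eqP; rewrite /eta.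
  by field; rewrite gt_eqF //= nat1r pnatr_eq0.
Qed.

Lemma box_null_sub (R : realType) (J : finType) (E E' : (J -> R) -> Prop) :
  (forall x, E x -> E' x) -> box_null E' -> box_null E.
Proof.
move=> sE nE eps /nE [a [b [ab cov vol]]].
by exists a, b; split=> // x /sE /cov.
Qed.

(** Multiplying by the right inverse of [V] turns [Phi] into a square matrix G + t I, singular
    wherever [Phi] is not row free. Its determinant is the characteristic polynomial of -G at t,
    hence monic in t. *)
Lemma box_null_not_row_free (R : realType) (J : finType) (j0 : J) (d q : nat)
    (Phi : (J -> R) -> 'M[R[i]]_(d.+1, q)) (V : 'M[R[i]]_(d.+1, q)) :
  row_free V -> (forall i k, loclip (fun x => Phi x i k)) ->
  (forall x t, Phi (upd x j0 t) = Phi (upd x j0 0) + t%:C *: V) ->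
  box_null (fun x => ~~ row_free (Phi x)).
Proof.
move=> fV lPhi PhiE.
apply: (@box_null_sub _ _ _ (fun x => \det (Phi x *m pinvmx V) = 0)).
  move=> x; rewrite -kermx_eq0 => /rowV0Pn [u /sub_kermxP uPhi u0].
  by apply/eqP/det0P; exists u; rewrite // mulmxA uPhi mul0mx.
apply: (@box_null_zeros _ _ j0 d (fun x => \det (Phi x *m pinvmx V))).
  apply: loclip_det => i k.
  apply: (loclip_ext (f := fun x => \sum_j Phi x i j * pinvmx V j k)).
    by move=> x; rewrite mxE.
  apply: loclip_sum => j _; apply: loclipM => //; exact: loclip_const.
move=> y; pose G := Phi (upd y j0 0) *m pinvmx V.
exists (char_poly (- G)); split; [exact: char_poly_monic | exact: size_char_poly |].
move=> t; rewrite PhiE mulmxDl -scalemxAl mulmxVp // /char_poly.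
rewrite -horner_evalE -det_map_mx; congr (\det _); apply/matrixP => i k.
rewrite !mxE /= /horner_eval hornerD hornerMn hornerX hornerN hornerC opprK.
by rewrite addrC mulr_natr.
Qed.

(** * The linear system of a frame *)

Lemma expr_subn (K : comPzRingType) (x y : K) m n :
  x * y = 1 -> (n <= m)%N -> x ^+ (m - n) = x ^+ m * y ^+ n.
Proof.
by move=> xy nm; rewrite -[in RHS](subnK nm) exprD -mulrA -exprMn xy expr1n mulr1.
Qed.

Section Frame.
Variables (R : realType) (N q D s : nat).
Variables (a : 'I_N -> R[i]) (z : 'I_q -> R[i]) (k : 'I_N).
Local Notation C := R[i].
Local Notation d := (D + D).+1.
Implicit Types x : 'I_N -> C.

Definition known_part x (i : 'I_q) : C := \sum_(n < N | (n <= s)%N) a n * x n * z i ^+ n.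

(* Row D + l is the Laurent monomial z^l of the system at x = e_k.  For
   l = n - k and l = k - n with n > s its unknown is the entry n of delta and its
   conjugate; for the remaining small |l| it is the coefficient of z^l in Q,
   whose row is scaled by Re (x k) so that the matrix is affine in Re (x k) with
   slope vander_mx. *)
Definition frame_mx x : 'M[C]_(d, q) := \matrix_(j, i)
  if (D + s < j + k)%N then Num.conj (known_part x i) * z i ^+ (j + k - D) / Num.conj (a k)
  else if (j + s < D + k)%N then known_part x i * Num.conj (z i) ^+ (D + k - j) / a k
  else (complex.Re (x k))%:C * (z i ^+ j * Num.conj (z i) ^+ D).

(** The exponents run from -D to D; negative powers are avoided since conj z inverts z on the unit
    circle. *)
Definition vander_mx : 'M[C]_(d, q) := \matrix_(j, i) (z i ^+ j * Num.conj (z i) ^+ D).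

Hypothesis z1 : forall i, z i * Num.conj (z i) = 1.

(** A vector of the left kernel is the coefficient vector of a polynomial of degree less than d with
    q >= d distinct roots. *)
Lemma vander_mx_free : injective z -> (d <= q)%N -> row_free vander_mx.
Proof.
move=> zI dq; apply: inj_row_free => u uV.
pose p := \poly_(j < d) u 0 (inord j).
have p0 : p = 0.
  apply/eqP; apply: contraTT dq => pn0; rewrite -ltnNge.
  have := max_poly_roots (rs := [seq z i | i <- enum 'I_q]) pn0.
  rewrite size_map size_enum_ord => H; apply: leq_trans (size_poly _ _).
  apply: H; last by rewrite map_inj_uniq // enum_uniq.
  apply/allP => _ /mapP[i _ ->]; rewrite /root /p horner_poly.
  have := congr1 (fun M : 'rV_q => M 0 i) uV; rewrite !mxE => uV0.
  have c0 : Num.conj (z i) ^+ D != 0.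
    rewrite expf_neq0 //; apply/eqP => e; have := z1 i; rewrite e mulr0.
    by move/esym/eqP; rewrite oner_eq0.
  rewrite -(inj_eq (mulIf c0)) mul0r mulr_suml -[X in _ == X]uV0.
  by apply/eqP/eq_bigr => j _; rewrite !mxE inord_val mulrA.
apply/rowP => j; rewrite mxE.
by have := congr1 (fun P : {poly C} => P`_j) p0; rewrite coef_poly ltn_ord coef0 inord_val.
Qed.

Lemma of_coordsE (c : 'I_N * bool -> R) n :
  of_coords c n = (c (n, true))%:C + 'i%C * (c (n, false))%:C.
Proof. by rewrite [LHS]complexE. Qed.

Lemma known_part_loclip i : loclip (fun c : 'I_N * bool -> R => known_part (of_coords c) i).
Proof.
apply: loclip_sum => n _.
apply: loclipM; last exact: loclip_const.
apply: loclipM; first exact: loclip_const.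
apply: (loclip_ext (f := fun c => (c (n, true))%:C + 'i%C * (c (n, false))%:C)).
  by move=> c; rewrite of_coordsE.
apply: loclipD; first exact: loclip_coord.
by apply: loclipM; [exact: loclip_const | exact: loclip_coord].
Qed.

Lemma known_part_upd (c : 'I_N * bool -> R) t i : (k <= s)%N ->
  known_part (of_coords (upd c (k, true) t)) i =
  known_part (of_coords (upd c (k, true) 0)) i + t%:C * (a k * z i ^+ k).
Proof.
move=> ks; rewrite /known_part !(bigD1 k ks) /=.
set S := \sum_(n < N | _) _; set S' := \sum_(n < N | _) _.
have -> : S' = S.
  apply: eq_bigr => n /andP[_ nk]; rewrite /of_coords /upd !xpair_eqE.
  by rewrite (negPf nk).
rewrite !of_coordsE /upd eqxx /=.
by rewrite xpair_eqE andbF rmorph0; ring.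
Qed.

(** Adding t to Re x[k] adds t z^(j-D) to row j in all three cases: dividing by [a k] or its
    conjugate and shifting the exponent by k cancel the factors of the k-th term of the known
    part. *)
Lemma frame_mx_null : injective z -> (d <= q)%N -> (k <= s)%N -> a k != 0 ->
  box_null (fun c : 'I_N * bool -> R => ~~ row_free (frame_mx (of_coords c))).
Proof.
move=> zI dq ks ak.
have cak : Num.conj (a k) != 0 by rewrite conjC_eq0.
apply: (box_null_not_row_free (j0 := (k, true)) (vander_mx_free zI dq)).
  - move=> j i; rewrite /frame_mx.
    case: (boolP (D + s < j + k)%N) => h1.
      apply: (loclip_ext (f := fun c => Num.conj (known_part (of_coords c) i) *
         (z i ^+ (j + k - D) / Num.conj (a k)))).
        by move=> c; rewrite mxE h1 mulrA.
      apply: loclipM; last exact: loclip_const.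
      exact/loclip_conj/known_part_loclip.
    case: (boolP (j + s < D + k)%N) => h2.
      apply: (loclip_ext (f := fun c => known_part (of_coords c) i *
         (Num.conj (z i) ^+ (D + k - j) / a k))).
        by move=> c; rewrite mxE (negPf h1) h2 mulrA.
      apply: loclipM; [exact: known_part_loclip | exact: loclip_const].
    apply: (loclip_ext (f := fun c => (c (k, true))%:C *
         (z i ^+ j * Num.conj (z i) ^+ D))).
      by move=> c; rewrite mxE (negPf h1) (negPf h2).
    apply: loclipM; [exact: loclip_coord | exact: loclip_const].
  - move=> c t; apply/matrixP => j i; rewrite !mxE (known_part_upd c t) //.
    have zk : z i ^+ k * Num.conj (z i) ^+ k = 1 by rewrite -exprMn z1 expr1n.
    have tJ : Num.conj (t%:C) = t%:C by exact: conjc_real.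
    case: ifPn => h1.
      rewrite rmorphD !rmorphM rmorphXn /= tJ (expr_subn (z1 i)) ?exprD; last first.
        by apply: leq_trans (ltnW h1); rewrite leq_addr.
      by rewrite -[z i ^+ j * _ in RHS]mul1r -zk; field.
    case: ifPn => h2.
      rewrite (@expr_subn _ _ (z i)) ?[_ * z i]mulrC // ?exprD; last first.
        by apply: leq_trans (ltnW h2); rewrite leq_addr.
      by rewrite -[z i ^+ j * _ in RHS]mul1r -zk; field.
    by rewrite /of_coords /upd eqxx /= mul0r add0r.
Qed.
End Frame.

(** * Positive semidefinite matrices *)

Section Psd.
Variables (R : realType) (N : nat).
Local Notation C := R[i].
Implicit Types (X : 'M[C]_N) (v : 'cV[C]_N).

Lemma adjmxE m n (A : 'M[C]_(m, n)) i j : adjmx A i j = Num.conj (A j i).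
Proof. by rewrite !mxE. Qed.

Lemma adjmxK m n (A : 'M[C]_(m, n)) : adjmx (adjmx A) = A.
Proof. by apply/matrixP => i j; rewrite !adjmxE conjCK. Qed.

Lemma adjmxD m n (A B : 'M[C]_(m, n)) : adjmx (A + B) = adjmx A + adjmx B.
Proof. by apply/matrixP => i j; rewrite !mxE rmorphD. Qed.

Lemma adjmxB m n (A B : 'M[C]_(m, n)) : adjmx (A - B) = adjmx A - adjmx B.
Proof. by apply/matrixP => i j; rewrite !mxE rmorphB. Qed.

Lemma adjmxZ m n c (A : 'M[C]_(m, n)) : adjmx (c *: A) = Num.conj c *: adjmx A.
Proof. by apply/matrixP => i j; rewrite !mxE rmorphM. Qed.

Lemma adjmxM m n p (A : 'M[C]_(m, n)) (B : 'M[C]_(n, p)) :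
  adjmx (A *m B) = adjmx B *m adjmx A.
Proof. by rewrite /adjmx map_mxM trmx_mul. Qed.

Lemma adjmx_delta m n (i : 'I_m) (j : 'I_n) : adjmx (delta_mx i j : 'M[C]_(m, n)) = delta_mx j i.
Proof. by apply/matrixP => k l; rewrite !mxE rmorph_nat andbC. Qed.

Lemma hermitianE X : Defs.hermitian X -> forall i j, X j i = Num.conj (X i j).
Proof. by move=> hX i j; rewrite -[in LHS]hX adjmxE. Qed.

Lemma psd_diag_ge0 X n : psd X -> 0 <= X n n.
Proof.
by move=> /(_ (delta_mx n 0)); rewrite adjmx_delta -rowE -colE !mxE.
Qed.

(** With a zero diagonal entry, the form at t e_n + e_p is affine in t, and a nonzero X n p would
    let it become negative. *)
Lemma psd_diag_eq0 X n : Defs.hermitian X -> psd X -> X n n = 0 -> forall p, X n p = 0.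
Proof.
move=> hX pX Xnn p; apply/eqP; apply/negPn/negP => Xnp.
have H (t : C) : 0 <= X p p + (Num.conj t * X n p + t * X p n).
  have := pX (t *: delta_mx n 0 + delta_mx p 0).
  rewrite adjmxD adjmxZ !adjmx_delta mulmxDl -scalemxAl -!rowE mulmxDr -!scalemxAr.
  rewrite -!colE !mxE Xnn !mulr0 add0r => H; apply: le_trans H _.
  by rewrite le_eqVlt; apply/orP; left; apply/eqP; ring.
have np0 : 0 < `|X n p| ^+ 2 by rewrite exprn_gt0 // normr_gt0.
have pp0 := psd_diag_ge0 p pX.
(* Chosen so that the form takes the value -1 at t = -(r * X n p). *)
pose r := (X p p + 1) / (2 * `|X n p| ^+ 2).
have r0 : 0 <= r by rewrite divr_ge0 ?addr_ge0 // mulr_ge0 // ltW.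
have := H (- (r * X n p)).
rewrite rmorphN rmorphM /= (CrealP (ger0_real r0)) (hermitianE hX n p).
set y := X n p; set y' := Num.conj y.
have yy : y * y' = `|y| ^+ 2 by rewrite normCK.
suff -> : X p p + (- (r * y') * y + - (r * y) * y') = -1.
  by rewrite oppr_ge0 => /le_lt_trans /(_ ltr01); rewrite ltxx.
transitivity (X p p - r * (2 * (y * y'))); first by ring.
rewrite yy /r divfK; last by rewrite lt0r_neq0 // mulr_gt0.
by rewrite opprD addNKr.
Qed.

(** The Schur complement of the entry (o, o), kept at size N; row and column [o] become zero when
    that entry is nonzero. *)
Definition schur X o : 'M[C]_N := X - (X o o)^-1 *: (col o X *m row o X).

Lemma schurE X o n p : schur X o n p = X n p - X n o * X o p / X o o.
Proof. by rewrite !mxE big_ord1 !mxE mulrC. Qed.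

Lemma schur_hermitian X o : Defs.hermitian X -> Defs.hermitian (schur X o).
Proof.
move=> hX; apply/matrixP => i j; rewrite adjmxE !schurE.
rewrite rmorphB !rmorphM /= fmorphV -!(hermitianE hX) /=.
by rewrite -(hermitianE hX) [X o j * _]mulrC.
Qed.

Definition sesq X (v w : 'cV[C]_N) : C := (adjmx v *m X *m w) 0 0.

Lemma sesqBZl X c u v w : sesq X (u - c *: v) w = sesq X u w - Num.conj c * sesq X v w.
Proof.
by rewrite /sesq adjmxB adjmxZ !mulmxBl -!scalemxAl mxE [X in _ + X]mxE [in X in _ - X]mxE.
Qed.

Lemma sesqBZr X c u v w : sesq X w (u - c *: v) = sesq X w u - c * sesq X w v.
Proof.
by rewrite /sesq !mulmxBr -!scalemxAr mxE [X in _ + X]mxE [in X in _ - X]mxE.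
Qed.

Lemma sesq_conj X v w : Defs.hermitian X -> Num.conj (sesq X v w) = sesq X w v.
Proof.
by move=> hX; rewrite /sesq -adjmxE !adjmxM hX mulmxA adjmxK.
Qed.

Lemma sesq_schur X o v :
  sesq (schur X o) v v =
  sesq X v v - sesq X v (delta_mx o 0) * sesq X (delta_mx o 0) v / X o o.
Proof.
rewrite /sesq /schur adjmx_delta mulmxBr mulmxBl -scalemxAr -scalemxAl.
rewrite mxE [X in _ + X]mxE [in X in _ - X]mxE colE rowE; congr (_ - _).
set e : 'cV[C]_N := delta_mx o 0; set e' : 'rV[C]_N := delta_mx 0 o.
have -> : adjmx v *m (X *m e *m (e' *m X)) *m v = (adjmx v *m X *m e) *m (e' *m X *m v).
  by rewrite !mulmxA.
by rewrite [X in _ * X]mxE big_ord1 mulrC.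
Qed.

(** Its form at v is the form of X at v - c e_o, where c makes this vector orthogonal to e_o with
    respect to X. *)
Lemma schur_psd X o : Defs.hermitian X -> psd X -> X o o != 0 -> psd (schur X o).
Proof.
move=> hX pX Xoo v; rewrite -/(sesq _ v v) sesq_schur.
pose e : 'cV[C]_N := delta_mx o 0.
have ee : sesq X e e = X o o by rewrite /sesq adjmx_delta -rowE -colE !mxE.
have cX : Num.conj (X o o) = X o o by rewrite -hermitianE.
have := pX (v - sesq X e v / X o o *: e); rewrite -/(sesq _ _ _).
rewrite sesqBZl !sesqBZr ee rmorphM fmorphV /= cX sesq_conj // -/e.
move=> H; apply: le_trans H _.
by rewrite le_eqVlt; apply/orP; left; apply/eqP; field.
Qed.
End Psd.

(** * Extending the known block *)

Section Extend.
Variables (R : realType) (N q D s t : nat).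
Local Notation C := R[i].
Variables (a : 'I_N -> C) (z : 'I_q -> C) (k : 'I_N).
Local Notation d := (D + D).+1.

Definition basis_row (j : nat) : 'rV[C]_d := delta_mx 0 (inord j).

Lemma basis_rowE i j : (i < d)%N -> (j < d)%N -> basis_row i 0 (inord j) = (i == j)%:R.
Proof.
move=> id jd; rewrite mxE eqxx /=; congr (nat_of_bool _)%:R.
by rewrite eq_sym -val_eqE /= !inordK.
Qed.

Hypothesis z1 : forall i, z i * Num.conj (z i) = 1.
Hypotheses (ks : (k <= s)%N) (tDk : (t <= D + k)%N) (tks : (t + k <= s + s.+1)%N).
Hypothesis ak : a k != 0.

Let I (n : 'I_N) := (s < n <= t)%N.

Lemma basis_row_hi x n i : I n ->
  (basis_row (D + n - k) *m frame_mx D s a z k x) 0 i =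
  Num.conj (known_part s a z x i) * z i ^+ n / Num.conj (a k).
Proof.
move=> /andP[sn nt]; rewrite -rowE !mxE inordK; last by lia.
have -> : (D + s < D + n - k + k)%N by lia.
by have -> : (D + n - k + k - D = n)%N by lia.
Qed.

Lemma basis_row_lo x n i : I n ->
  (basis_row (D + k - n) *m frame_mx D s a z k x) 0 i =
  known_part s a z x i * Num.conj (z i) ^+ n / a k.
Proof.
move=> /andP[sn nt]; rewrite -rowE !mxE inordK; last by lia.
have -> : (D + s < D + k - n + k)%N = false by lia.
have -> : (D + k - n + s < D + k)%N by lia.
by have -> : (D + k - (D + k - n) = n)%N by lia.
Qed.

Lemma basis_row_mid x n p i : I n -> I p ->
  (basis_row (D + n - p) *m frame_mx D s a z k x) 0 i =
  (complex.Re (x k))%:C * (z i ^+ n * Num.conj (z i) ^+ p).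
Proof.
move=> /andP[sn nt] /andP[sp pt]; rewrite -rowE !mxE inordK; last by lia.
have -> : (D + s < D + n - p + k)%N = false by lia.
have -> : (D + n - p + s < D + k)%N = false by lia.
congr (_ * _); rewrite (expr_subn (z1 i)); last by lia.
have zD : z i ^+ D * Num.conj (z i) ^+ D = 1 by rewrite -exprMn z1 expr1n.
by rewrite exprD -[RHS]mul1r -zD; ring.
Qed.

(** The assumed identity says that a combination [u] of rows of the matrix vanishes. By [tDk] the
    exponents n - k, k - n and n - p stay within [-D, D], and by [tks] they fill disjoint ranges, so
    each coordinate of [u] = 0 involves only one of the three sums. *)
Lemma frame_mx_solution x (delta : 'I_N -> C) (G : 'I_N -> 'I_N -> C) :
  row_free (frame_mx D s a z k x) ->
  (forall i,
     Num.conj (known_part s a z x i) * (\sum_(n | I n) delta n * z i ^+ n)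
     + known_part s a z x i * Num.conj (\sum_(n | I n) delta n * z i ^+ n)
     + \sum_(n | I n) \sum_(p | I p) G n p * (z i ^+ n * Num.conj (z i) ^+ p) = 0) ->
  (forall n, I n -> delta n = 0) /\ \sum_(n | I n) G n n = 0.
Proof.
move=> fPhi H.
have addE m (A B : 'rV[C]_m) i : (A + B) 0 i = A 0 i + B 0 i by rewrite mxE.
have cak : Num.conj (a k) != 0 by rewrite conjC_eq0.
pose tau : C := (complex.Re (x k))%:C.
(* If Re x[k] were 0, row [D] of the matrix would be zero, against row freeness. *)
have tau0 : tau != 0.
  apply/eqP => tau0; have := row_free_inj fPhi (x1 := basis_row D) (x2 := 0).
  rewrite mul0mx => e.
  have /e : basis_row D *m frame_mx D s a z k x = 0.
    apply/rowP => i; rewrite -rowE !mxE inordK; last by lia.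
    have -> : (D + s < D + k)%N = false by lia.
    by rewrite -/tau tau0 mul0r.
  move=> /rowP /(_ (inord D)); rewrite basis_rowE ?mxE ?eqxx; try by lia.
  by move/eqP; rewrite oner_eq0.
pose u := \sum_(n | I n) (Num.conj (a k) * delta n) *: basis_row (D + n - k)
  + \sum_(n | I n) (a k * Num.conj (delta n)) *: basis_row (D + k - n)
  + \sum_(n | I n) \sum_(p | I p) (G n p / tau) *: basis_row (D + n - p).
have u0 : u = 0.
  apply: (row_free_inj fPhi); rewrite mul0mx; apply/rowP => i.
  rewrite [RHS]mxE -[RHS](H i) /u !mulmxDl !mulmx_suml.
  rewrite 2!addE 3!summxE.
  congr (_ + _ + _).
  - rewrite mulr_sumr; apply: eq_bigr => n In.
    by rewrite -scalemxAl mxE basis_row_hi //; field.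
  - rewrite rmorph_sum mulr_sumr; apply: eq_bigr => n In.
    by rewrite -scalemxAl mxE basis_row_lo // rmorphM rmorphXn; field.
  - apply: eq_bigr => n In; rewrite mulmx_suml summxE; apply: eq_bigr => p Ip.
    by rewrite -scalemxAl mxE basis_row_mid // -/tau; field.
have uE j : (j < d)%N -> 0 =
    \sum_(n | I n) (Num.conj (a k) * delta n) * (D + n - k == j)%N%:R
  + \sum_(n | I n) (a k * Num.conj (delta n)) * (D + k - n == j)%N%:R
  + \sum_(n | I n) \sum_(p | I p) (G n p / tau) * (D + n - p == j)%N%:R.
  move=> jd; transitivity (u 0 (inord j)); first by rewrite u0 mxE.
  rewrite /u 2!addE 3!summxE.
  congr (_ + _ + _).
  - by apply: eq_bigr => n /andP[? ?]; rewrite mxE basis_rowE //; lia.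
  - by apply: eq_bigr => n /andP[? ?]; rewrite mxE basis_rowE //; lia.
  - apply: eq_bigr => n /andP[? ?]; rewrite summxE; apply: eq_bigr => p /andP[? ?].
    by rewrite mxE basis_rowE //; lia.
split.
  move=> n0 In0; have /andP[sn0 n0t] := In0.
  have := uE (D + n0 - k)%N; rewrite [X in _ + X + _]big1; last first.
    by move=> n /andP[? ?]; rewrite (_ : (_ == _) = false) ?mulr0 //; apply/eqP; lia.
  rewrite [X in _ + X]big1; last first.
    move=> n /andP[? ?]; rewrite big1 // => p /andP[? ?].
    by rewrite (_ : (_ == _) = false) ?mulr0 //; apply/eqP; lia.
  rewrite (bigD1 n0) //= eqxx mulr1 big1 ?addr0; last first.
    move=> n /andP[/andP[? ?] nn0].
    rewrite (_ : (_ == _) = false) ?mulr0 //; apply/eqP => e.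
    by case/eqP: nn0; apply/val_inj => /=; lia.
  move=> e; have /e/esym/eqP : (D + n0 - k < d)%N by lia.
  by rewrite mulf_eq0 (negPf cak) => /eqP.
(* Coordinate [D] carries the exponent 0 and collects exactly the terms with n = p. *)
have := uE D; rewrite [X in X + _ + _]big1; last first.
  by move=> n /andP[? ?]; rewrite (_ : (_ == _) = false) ?mulr0 //; apply/eqP; lia.
rewrite [X in _ + X + _]big1; last first.
  by move=> n /andP[? ?]; rewrite (_ : (_ == _) = false) ?mulr0 //; apply/eqP; lia.
rewrite !add0r => e; have {}e := e (leq_addr _ _).
have itau : tau^-1 != 0 by rewrite invr_eq0.
apply: (mulIf itau); rewrite mul0r [RHS]e mulr_suml.
apply: eq_bigr => n In; rewrite (bigD1 n) //= addnK eqxx mulr1 big1 ?addr0 //.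
move=> p /andP[/andP[? ?] pn]; rewrite (_ : (_ == _) = false) ?mulr0 //; apply/eqP => ee.
by move/andP: In => [? ?]; case/eqP: pn; apply/val_inj => /=; lia.
Qed.
End Extend.

Lemma extend_block (R : realType) (N q D s t : nat) (a x0 : 'I_N -> R[i])
    (z : 'I_q -> R[i]) (k o : 'I_N) (X : 'M[R[i]]_N) :
  (forall i, z i * Num.conj (z i) = 1) ->
  (k <= s)%N -> (t <= D + k)%N -> (t + k <= s + s.+1)%N -> a k != 0 ->
  (forall n : 'I_N, (t < n)%N -> a n = 0) ->
  (forall n : 'I_N, (s < n <= t)%N -> a n != 0) ->
  row_free (frame_mx D s a z k x0) ->
  Defs.hermitian X -> psd X -> (o <= s)%N -> x0 o != 0 ->
  (forall i, \sum_n \sum_p (a n * z i ^+ n) * X n p * Num.conj (a p * z i ^+ p) =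
     \sum_n \sum_p (a n * z i ^+ n) * (x0 n * Num.conj (x0 p)) * Num.conj (a p * z i ^+ p)) ->
  (forall n p : 'I_N, (n <= s)%N -> (p <= s)%N -> X n p = x0 n * Num.conj (x0 p)) ->
  forall n p : 'I_N, (n <= t)%N -> (p <= t)%N -> X n p = x0 n * Num.conj (x0 p).
Proof.
move=> z1 ks tDk tks ak a_t a_st fPhi hX pX os xo meas blk.
have cxo : Num.conj (x0 o) != 0 by rewrite conjC_eq0.
have Xoo : X o o = x0 o * Num.conj (x0 o) by rewrite blk.
have Xoo0 : X o o != 0 by rewrite Xoo mulf_neq0.
(* Column [o] of X, scaled to agree with x0 on the known indices. *)
pose v n := X n o / Num.conj (x0 o).
pose S := schur X o.
have hS : Defs.hermitian S := schur_hermitian o hX.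
have pS : psd S := schur_psd hX pX Xoo0.
have XE n p : X n p = v n * Num.conj (v p) + S n p.
  rewrite /S schurE (hermitianE hX p o) /v Xoo rmorphM fmorphV /= conjCK.
  by field; rewrite ?xo ?cxo.
have vs (n : 'I_N) : (n <= s)%N -> v n = x0 n by move=> ns; rewrite /v blk // mulfK.
have S0 (n p : 'I_N) : (n <= s)%N -> S n p = 0.
  move=> ns; apply: psd_diag_eq0 => //.
  by apply: (addrI (v n * Num.conj (v n))); rewrite -XE addr0 blk // vs.
have S0' (n p : 'I_N) : (p <= s)%N -> S n p = 0.
  by move=> ps; rewrite (hermitianE hS p n) S0 // rmorph0.
clearbody v S.
pose H n p := X n p - x0 n * Num.conj (x0 p).
pose delta n := a n * (v n - x0 n).
(* The new block enters as a whole, the quadratic terms in delta included; only once delta = 0 does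
   the diagonal reduce to |a n|^2 * S n n. *)
pose G n p := a n * Num.conj (a p) * H n p.
have [delta0 G0] : (forall n : 'I_N, (s < n <= t)%N -> delta n = 0) /\
    \sum_(n < N | (s < n <= t)%N) G n n = 0.
  apply: (frame_mx_solution z1 ks tDk tks ak fPhi) => i.
  pose F n p := (a n * z i ^+ n) * H n p * Num.conj (a p * z i ^+ p).
  have F0 : \sum_n \sum_p F n p = 0.
    apply/eqP; rewrite -[X in _ == X](subrr (\sum_n \sum_p
      (a n * z i ^+ n) * (x0 n * Num.conj (x0 p)) * Num.conj (a p * z i ^+ p))).
    rewrite -{1}meas -sumrB; apply/eqP/eq_bigr => n _; rewrite -sumrB.
    by apply: eq_bigr => p _; rewrite /F /H; ring.
  have split (f : 'I_N -> R[i]) : (forall n : 'I_N, (t < n)%N -> f n = 0) ->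
      \sum_n f n = \sum_(n < N | (n <= s)%N) f n + \sum_(n < N | (s < n <= t)%N) f n.
    move=> ft; rewrite (bigID (fun n : 'I_N => (n <= s)%N)) /=; congr (_ + _).
    rewrite (bigID (fun n : 'I_N => (n <= t)%N)) /= [X in _ + X]big1 ?addr0.
      by apply: eq_bigl => n; rewrite -ltnNge.
    by move=> n /andP[_]; rewrite -ltnNge => /ft.
  have Fl (n p : 'I_N) : (t < n)%N -> F n p = 0 by move=> /a_t an; rewrite /F an !mul0r.
  have Fr (n p : 'I_N) : (t < p)%N -> F n p = 0.
    by move=> /a_t ap; rewrite /F ap mul0r rmorph0 mulr0.
  rewrite -[RHS]F0 [RHS]split; last by move=> n tn; rewrite big1 // => p _; exact: Fl.
  have splitF n : \sum_p F n p =
      \sum_(p < N | (p <= s)%N) F n p + \sum_(p < N | (s < p <= t)%N) F n p.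
    by apply: split => p; apply: Fr.
  rewrite !(eq_bigr _ (fun n _ => splitF n)).
  (* The known block contributes nothing. On the mixed blocks S vanishes, which leaves the terms
     linear in delta and its conjugate. *)
  rewrite !big_split /= [X in _ = X + _ + _]big1 ?add0r; last first.
    by move=> n ns; rewrite big1 // => p ps; rewrite /F /H blk // subrr mulr0 mul0r.
  rewrite addrA [X in X + _ = _]addrC; congr (_ + _ + _).
  - rewrite rmorph_sum /known_part big_distrlr /=; apply: eq_bigr => n ns.
    apply: eq_bigr => p _; rewrite /F /H XE S0 // vs // /delta !rmorphM rmorphB /=.
    ring.
  - rewrite rmorph_sum /known_part mulrC big_distrlr /=; apply: eq_bigr => n _.
    apply: eq_bigr => p ps; rewrite /F /H XE S0' // (vs p) // /delta !rmorphM /=.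
    ring.
  - apply: eq_bigr => n _; apply: eq_bigr => p _.
    by rewrite /G /F rmorphM rmorphXn /=; ring.
have vt (n : 'I_N) : (n <= t)%N -> v n = x0 n.
  move=> nt; case: (leqP n s) => [/vs//|sn].
  have snt : (s < n <= t)%N by rewrite sn.
  have /eqP := delta0 n snt.
  by rewrite mulf_eq0 (negPf (a_st n snt)) /= subr_eq0 => /eqP.
have St (n p : 'I_N) : (n <= t)%N -> S n p = 0.
  move=> nt; case: (leqP n s) => [/S0//|sn].
  have snt : (s < n <= t)%N by rewrite sn.
  apply: psd_diag_eq0 => //.
  have GE (m : 'I_N) : (s < m <= t)%N -> G m m = `|a m| ^+ 2 * S m m.
    move=> /andP[_ mt]; rewrite /G /H XE vt // normCK; ring.
  have G_ge0 (m : 'I_N) : (s < m <= t)%N -> 0 <= G m m.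
    by move=> mst; rewrite GE // mulr_ge0 ?exprn_ge0 // psd_diag_ge0.
  have /eqP := psumr_eq0P G_ge0 G0 snt.
  by rewrite GE // mulf_eq0 expf_eq0 normr_eq0 (negPf (a_st n snt)) andbF => /eqP.
by move=> n p nt pt; rewrite XE St // addr0 !vt.
Qed.

(** * STFT measurements *)

Section Expi.
Variable R : realType.
Implicit Types t u : R.

Lemma expiD t u : expi (t + u) = expi t * expi u.
Proof. by rewrite /expi cosD sinD; simpc; congr (_ +i* _); rewrite addrC. Qed.

Lemma expi_natmul t n : expi (t * n%:R) = expi t ^+ n.
Proof.
elim: n => [|n IH]; first by rewrite mulr0 /expi cos0 sin0.
by rewrite -natr1 mulrDr mulr1 expiD IH exprSr.
Qed.

Lemma expi_conj t : Num.conj (expi t) = expi (- t).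
Proof. by rewrite /expi cosN sinN. Qed.

Lemma expi_mul_conj t : expi t * Num.conj (expi t) = 1.
Proof. by rewrite expi_conj -expiD subrr /expi cos0 sin0. Qed.

(** If cos t = 1 then sin (t/2) = 0, but t/2 lies strictly between 0 and pi. *)
Lemma expi_neq1 t : 0 < t < 2 * pi -> expi t != 1.
Proof.
move=> /andP[t0 t2]; apply/eqP => -[ct _].
have s0 : 0 < sin (t / 2).
  by apply: sin_gt0_pi; rewrite divr_gt0 //= ltr_pdivrMr // mulrC.
have := cosD (t / 2) (t / 2); rewrite -splitr ct => e.
have := cos2Dsin2 (t / 2); rewrite !expr2 => e'.
have : 0 < sin (t / 2) * sin (t / 2) by rewrite mulr_gt0.
lra.
Qed.

Lemma expi_unit_roots_inj (N m m' : nat) : (0 < m <= N)%N -> (0 < m' <= N)%N ->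
  expi (2 * pi * m%:R / N%:R : R) = expi (2 * pi * m'%:R / N%:R) -> m = m'.
Proof.
wlog mm' : m m' / (m < m')%N => [W|] mN m'N e.
  by case: (ltngtP m m') => // h; [apply: W | apply/esym/W].
have N0 : 0 < N%:R :> R by rewrite ltr0n; lia.
have pi0 : 0 < pi :> R := pi_gt0 R.
have /eqP[] : expi (2 * pi * (m' - m)%:R / N%:R : R) != 1.
  apply: expi_neq1; apply/andP; split.
    by rewrite divr_gt0 // mulr_gt0 ?mulr_gt0 // ltr0n subn_gt0.
  by rewrite ltr_pdivrMr // ltr_pM2l ?mulr_gt0 // ltr_nat; lia.
by rewrite natrB 1?ltnW // mulrBr mulrBl expiD -expi_conj e expi_mul_conj.
Qed.
End Expi.

Section Measurements.
Variables (R : realType) (N W L : nat) (w : 'I_W -> R[i]).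
Local Notation C := R[i].

(** Conjugated because [fvec] enters through its adjoint; the frame sums are then polynomials in
    this node. *)
Definition freq (m : nat) : C := Num.conj (expi (2 * pi * m%:R / N%:R)).

Definition frame_weight (r : nat) (n : 'I_N) : C := wext w ((r * L)%:Z - (n : nat)%:Z).

Lemma freq_mul_conj m : freq m * Num.conj (freq m) = 1.
Proof. by rewrite /freq conjCK mulrC expi_mul_conj. Qed.

Lemma frame_rowE m r n :
  (adjmx (fvec R N m) *m Wmat N L w r) 0 n = frame_weight r n * freq m ^+ n.
Proof.
rewrite mul_mx_diag !mxE mulrC /freq -rmorphXn -expi_natmul /=.
by congr (_ * Num.conj (expi _)); rewrite mulrAC.
Qed.

(** With g the row f_m^* W_r, cyclicity turns the trace into g X g^*. *)
Lemma trace_frameE m r (X : 'M[C]_N) :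
  \tr (adjmx (Wmat N L w r) *m fvec R N m *m adjmx (fvec R N m) *m Wmat N L w r *m X) =
  \sum_n \sum_p (frame_weight r n * freq m ^+ n) * X n p *
     Num.conj (frame_weight r p * freq m ^+ p).
Proof.
set g := adjmx (fvec R N m) *m Wmat N L w r.
have -> : adjmx (Wmat N L w r) *m fvec R N m *m adjmx (fvec R N m) *m Wmat N L w r *m X =
    adjmx g *m (g *m X).
  by rewrite /g adjmxM adjmxK !mulmxA.
rewrite mxtrace_mulC /mxtrace big_ord1 mxE exchange_big /=.
apply: eq_bigr => p _; rewrite mxE mulr_suml; apply: eq_bigr => n _.
by rewrite adjmxE !frame_rowE.
Qed.

Lemma outerE (x : 'I_N -> C) n p : (colv x *m adjmx (colv x)) n p = x n * Num.conj (x p).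
Proof. by rewrite mxE big_ord1 adjmxE !mxE. Qed.

Lemma Zw_trace m r (x : 'I_N -> C) :
  Zw L w x m r = \tr (adjmx (Wmat N L w r) *m fvec R N m *m adjmx (fvec R N m) *m
    Wmat N L w r *m (colv x *m adjmx (colv x))).
Proof.
rewrite trace_frameE /Zw normCK mxE rmorph_sum big_distrlr /=.
apply: eq_bigr => n _; apply: eq_bigr => p _.
rewrite outerE !frame_rowE !mxE rmorphM; ring.
Qed.

Lemma outer_feasible M (x : 'I_N -> C) : feasible L M w x (colv x *m adjmx (colv x)).
Proof.
split.
- by rewrite /Defs.hermitian adjmxM adjmxK.
- move=> v; rewrite mulmxA -mulmxA.
  have -> : adjmx (colv x) *m v = adjmx (adjmx v *m colv x).
    by rewrite adjmxM adjmxK.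
  by rewrite mxE big_ord1 adjmxE mul_conjC_ge0.
- by move=> m r _ _; rewrite Zw_trace.
- by move=> n p _ _; rewrite outerE.
Qed.

Lemma wext_neq0 n : (forall j, w j != 0) -> (n < W)%N -> wext w n%:Z != 0.
Proof. by move=> w0 nW; rewrite /= insubT. Qed.

Lemma frame_weight_neq0 r (n : 'I_N) : (forall j, w j != 0) ->
  (n <= r * L < n + W)%N -> frame_weight r n != 0.
Proof.
move=> w0 /andP[nr rn]; rewrite /frame_weight subzn //; apply: wext_neq0 => //; lia.
Qed.

Lemma frame_weight_eq0 r (n : 'I_N) : (r * L < n)%N -> frame_weight r n = 0.
Proof.
move=> rn; rewrite /frame_weight -opprB subzn 1?ltnW //.
by have := subn_gt0 (r * L) n; rewrite rn; case: (n - _)%N.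
Qed.
End Measurements.

(** * The exceptional set and the induction over frames *)

Theorem theorem2 (R : realType) (N W L M : nat) (w : 'I_W -> R[i]) :
  (0 < N)%N -> (0 < W)%N -> (0 < L)%N -> (0 < M)%N ->
  (forall n : 'I_W, w n != 0) ->
  (2 * L <= W)%N -> (2 * W <= N)%N ->
  (4 * L <= M)%N -> (M <= N)%N ->
  exists E : ('I_N -> R[i]) -> Prop, null_set E /\
    forall x0 : 'I_N -> R[i], (forall n, x0 n != 0) -> ~ E x0 ->
      feasible L M w x0 (colv x0 *m adjmx (colv x0)) /\
      forall X : 'M[R[i]]_N, feasible L M w x0 X -> X = colv x0 *m adjmx (colv x0).
Proof.
move=> N0 W0 L0 M0 w0 LW WN LM MN.
pose o : 'I_N := Ordinal N0.
pose D := (2 * L).-1.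
pose z (i : 'I_(4 * L)) := freq R N i.+1.
(* Off by one: s r and pivot r serve frame r + 1; pivot r is the index k of the header. *)
pose s r := if r == 0%N then L./2 else (r * L)%N.
pose pivot r := if r == 0%N then 0%N else (r.-1 * L).+1.
have z1 i : z i * Num.conj (z i) = 1 by exact: freq_mul_conj.
have zI : injective z.
  move=> i j /(can_inj (@conjCK _)) /expi_unit_roots_inj e; apply/val_inj/eq_add_S/e.
    have := ltn_ord i; lia.
  have := ltn_ord j; lia.
have half := odd_double_half L.
(* In order: the pivot is known, its distances to new indices are at most [D], they exceed all
   differences of new indices, and the window does not vanish at the pivot. *)
have pivot_bounds r : [/\ (pivot r <= s r)%N, (r.+1 * L <= D + pivot r)%N,
    (r.+1 * L + pivot r <= s r + (s r).+1)%N & (pivot r <= r.+1 * L < pivot r + W)%N].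
  rewrite /pivot /s /D; case: r => [|r] /=; first by split; lia.
  by rewrite !mulSn; move: (r * L)%N => rL; split; lia.
(* All r are allowed; if [pivot r] is at least N, no [k] exists and the piece is empty. *)
pose E x := exists r, exists k : 'I_N, k = pivot r :> nat /\
   ~~ row_free (frame_mx D (s r) (frame_weight L w r.+1) z k x).
exists E; split.
  apply: box_null_set; apply: (box_null_bigcup (o, true)) => r.
  have [ks _ _ ak] := pivot_bounds r.
  have [kN|Nk] := ltnP (pivot r) N; last first.
    apply: (box_null_sub (E' := fun=> False)).
      by move=> c [k [e _]]; have := ltn_ord k; rewrite e ltnNge Nk.
    apply: (box_null_count (o, true)) => eps eps0.
    exists void, (of_void _), (of_void _); split=> [[]|c []|].
    by case=> [_|[]]; rewrite big_nil ltW.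
  pose k := Ordinal kN.
  apply: box_null_sub (frame_mx_null (D := D) (a := frame_weight L w r.+1) (k := k) z1 zI _ ks _).
  - by move=> c [k' [e nf]]; have <- : k' = k by exact: val_inj.
  - by rewrite /D; lia.
  - exact: frame_weight_neq0.
move=> x0 x00 nE; split; first exact: outer_feasible.
move=> X [hX pX meas blk].
have block r : (r < nframes N W L)%N -> forall n p : 'I_N,
    (n <= s r)%N -> (p <= s r)%N -> X n p = x0 n * Num.conj (x0 p).
  elim: r => [_|r IH rN]; first exact: blk.
  have {}IH := IH (ltnW rN).
  have [ks tDk tks ak] := pivot_bounds r.
  have [kN|Nk] := ltnP (pivot r) N; last first.
    (* Here every index is below the pivot, hence already known. *)
    by move=> n p _ _; apply: IH; apply: leq_trans ks; apply: leq_trans Nk; apply: ltnW.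
  pose k := Ordinal kN.
  apply: (extend_block (a := frame_weight L w r.+1) (o := o) (k := k) z1 ks tDk tks) => //.
  - exact: frame_weight_neq0.
  - exact: frame_weight_eq0.
  - move=> n /andP[sn nt]; apply: frame_weight_neq0 => //.
    rewrite nt /=; move: sn; rewrite /s; case: (r) => [|r'] /=; first by lia.
    by rewrite !mulSn; move: (r' * L)%N => rL; lia.
  - by apply/negPn/negP => nf; apply: nE; exists r, k.
  - move=> i; have mi : (1 <= i.+1 <= M)%N by have := ltn_ord i; lia.
    rewrite -trace_frameE meas // Zw_trace trace_frameE.
    by apply: eq_bigr => n _; apply: eq_bigr => p _; rewrite outerE.
(* The least r with N - 1 <= r * L, so that the block of frame r is the whole matrix. *)
pose r := ((N - 1 + (L - 1)) %/ L)%N.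
have rL : (N - 1 <= r * L)%N.
  have := divn_eq (N - 1 + (L - 1)) L; rewrite -/r.
  have := ltn_pmod (N - 1 + (L - 1)) L0; lia.
have rlt : (r < nframes N W L)%N.
  rewrite /nframes leq_divRL // mulSn.
  have := leq_divM (N - 1 + (L - 1)) L; rewrite -/r; lia.
(* Ensures that [s r] is r * L and not the initial [L./2]. *)
have r0 : (0 < r)%N.
  by rewrite lt0n; apply/eqP => r0; move: rL; rewrite r0; lia.
apply/matrixP => n p; rewrite outerE; apply: (block r rlt).
  by rewrite /s; case: (r) r0 rL => //= r' _; have := ltn_ord n; lia.
by rewrite /s; case: (r) r0 rL => //= r' _; have := ltn_ord p; lia.
Qed.
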